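(* Let $G$ be a finite group of order $v$ and let $D'$ be a Paley type partial difference set in $G$, that is, a partial difference set with parameters $\left(v,\frac{v-1}{2},\frac{v-5}{4},\frac{v-1}{4}\right)$. Then there exists a signed difference set $D$ in $G$ with parameters $(v,v-1,-1)$.
   Context: For a finite group $G$ of order $v$, with identity written $0_G$, a subset $S\subseteq G$ is identified with $\sum_{s\in S}s$ in the group ring $\mathbb{Z}[G]$. For $A=\sum_g a_g g\in\mathbb{Z}[G]$ put $A^{-1}=\sum_g a_g g^{-1}$. A $k$-element subset $D'\subseteq G$ is a $(v,k,\lambda,\mu)$-partial difference set (PDS) if $D'D'^{-1}=\lambda D'+\mu(G-D'-0_G)+k\cdot 0_G$ in $\mathbb{Z}[G]$. Let $D=\sum_{i=1}^k s_id_i\in\mathbb{Z}[G]$ with distinct $d_i\in G$ and $s_i\in\{-1,1\}$. $D$ is a $(v,k,\lambda)$-signed difference set (SDS) in $G$ if $DD^{-1}=\lambda G+(k-\lambda)\cdot 0_G$, where $\lambda$ is an integer. *)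

(* Defs.v *)
From HB Require Import structures.
From mathcomp Require Import all_boot all_order all_algebra all_fingroup.

Set Implicit Arguments.
Unset Strict Implicit.
Unset Printing Implicit Defensive.

Import Order.TTheory GRing.Theory Num.Theory.
Local Open Scope ring_scope.

(* The group ring Z[gT]. It is a separate name for {ffun gT -> int} so that   *)
(* its product is convolution, not the pointwise product.                     *)
Definition zgroup_ring (gT : finGroupType) : Type := {ffun gT -> int}.

Section GroupRing.
Variable gT : finGroupType.
Local Notation ZG := (zgroup_ring gT).
Implicit Types (A B C : ZG) (g h : gT) (S : {set gT}).

HB.instance Definition _ := GRing.Zmodule.copy ZG {ffun gT -> int}.

Definition zg_coef A g : int := (A : {ffun gT -> int}) g.

Definition zg_elt g : ZG := [ffun h => (h == g)%:R : int].

Definition zg_mul A B : ZG :=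
  [ffun g => \sum_h zg_coef A h * zg_coef B (h^-1 * g)%g].

Lemma zg_coefP A B : (forall g, zg_coef A g = zg_coef B g) -> A = B.
Proof. by move=> eqAB; apply/ffunP. Qed.

Lemma zg_coefD A B g : zg_coef (A + B) g = zg_coef A g + zg_coef B g.
Proof. by rewrite /zg_coef ffunE. Qed.

Lemma zg_coef_elt g h : zg_coef (zg_elt g) h = (h == g)%:R.
Proof. by rewrite /zg_coef ffunE. Qed.

Lemma zg_coef_mul A B g :
  zg_coef (zg_mul A B) g = \sum_h zg_coef A h * zg_coef B (h^-1 * g)%g.
Proof. by rewrite /zg_coef ffunE. Qed.

Fact zg_mulA : associative zg_mul.
Proof.
move=> A B C; apply: zg_coefP => g; rewrite !zg_coef_mul.
under eq_bigr => h _ do rewrite zg_coef_mul big_distrr /=.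
under [RHS]eq_bigr => h _ do rewrite zg_coef_mul big_distrl /=.
rewrite [RHS]exchange_big /=; apply: eq_bigr => h _.
rewrite [RHS](reindex_inj (mulgI h)) /=; apply: eq_bigr => x _.
by rewrite mulKg invMg mulrA !mulgA.
Qed.

Fact zg_mul1l : left_id (zg_elt 1%g) zg_mul.
Proof.
move=> A; apply: zg_coefP => g; rewrite zg_coef_mul (bigD1 1%g) //=.
rewrite big1 => [|h /negPf h1]; rewrite zg_coef_elt; last by rewrite h1 mul0r.
by rewrite eqxx mul1r addr0 invg1 mul1g.
Qed.

Fact zg_mul1r : right_id (zg_elt 1%g) zg_mul.
Proof.
move=> A; apply: zg_coefP => g; rewrite zg_coef_mul (bigD1 g) //=.
rewrite big1 => [|h hg]; rewrite zg_coef_elt.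
  by rewrite mulVg eqxx mulr1 addr0.
by rewrite -eq_mulVg1 (negPf hg) mulr0.
Qed.

Fact zg_mulDl : left_distributive zg_mul +%R.
Proof.
move=> A B C; apply: zg_coefP => g; rewrite zg_coefD !zg_coef_mul -big_split.
by apply: eq_bigr => h _; rewrite zg_coefD mulrDl.
Qed.

Fact zg_mulDr : right_distributive zg_mul +%R.
Proof.
move=> A B C; apply: zg_coefP => g; rewrite zg_coefD !zg_coef_mul -big_split.
by apply: eq_bigr => h _; rewrite zg_coefD mulrDr.
Qed.

Fact zg_one_neq0 : zg_elt 1%g != 0.
Proof.
apply/eqP => /(congr1 (fun A : ZG => zg_coef A 1%g)).
by rewrite zg_coef_elt eqxx /zg_coef ffunE.
Qed.

HB.instance Definition _ := GRing.Zmodule_isNzRing.Build ZG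
  zg_mulA zg_mul1l zg_mul1r zg_mulDl zg_mulDr zg_one_neq0.

Definition zg_set S : ZG := \sum_(s in S) zg_elt s.

Definition zg_inv A : ZG := \sum_g zg_elt g^-1%g *~ zg_coef A g.

(* Below, the group identity 0_G, as an element of Z[gT], is the ring unit 1  *)
(* (which is zg_elt 1%g by definition); lambda and mu are integers and may be *)
(* negative.                                                                  *)

Definition is_PDS (D' : {set gT}) (v k : nat) (lambda mu : int) : Prop :=
  [/\ #|gT| = v, #|D'| = k
    & zg_set D' * zg_inv (zg_set D')
      = zg_set D' *~ lambda + (zg_set [set: gT] - zg_set D' - 1) *~ mu
        + 1 *+ k].

(* The parameters are compared in rat, so the divisions are exact.            *)
Definition is_Paley_PDS (D' : {set gT}) (v : nat) : Prop :=
  exists (k : nat) (lambda mu : int),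
    [/\ is_PDS D' v k lambda mu,
        k%:Q = (v%:Q - 1) / 2,
        lambda%:Q = (v%:Q - 5) / 4
      & mu%:Q = (v%:Q - 1) / 4].

Definition is_SDS (D : ZG) (v k : nat) (lambda : int) : Prop :=
  [/\ #|gT| = v,
      exists (d : 'I_k -> gT) (s : 'I_k -> int),
        [/\ injective d, forall i, s i = -1 \/ s i = 1
          & D = \sum_(i < k) zg_elt (d i) *~ s i]
    & D * zg_inv D = zg_set [set: gT] *~ lambda + 1 *~ (k%:Z - lambda)].

End GroupRing.

(* Main.v *)
(* Write v = 4m + 1 and S = zg_set D'.  The Paley parameters turn the PDS      *)
(* equation into S S^-1 = m G - S + m.  Its left-hand side is fixed by         *)
(* inversion, so S = S^-1, and comparing the coefficients of the identity      *)
(* shows that the identity is not in D'.  Hence D = S - (G - S - 1)            *)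
(* = 2 S - G + 1 has coefficients +1 or -1 exactly off the identity, and       *)
(* expanding its square gives D D^-1 = D^2 = v - G.                            *)
Require Import Defs.
From HB Require Import structures.
From mathcomp Require Import all_boot all_order all_algebra all_fingroup.
From mathcomp Require Import ring lra zify.

Import Order.TTheory GRing.Theory Num.Theory.
Local Open Scope ring_scope.

(** [D] imitates the quadratic character of a finite field: +1 on [D'], -1 on the other nonidentity
    elements, 0 at the identity. Since [D] is symmetric, the claim is that its square is v - G. That
    computation stays inside the integer span of 1, S and G, which is closed under multiplication:
    [Paley_PDS_eq] with [Paley_PDS_sym] gives S S, and [zg_mul_setT], [zg_setT_mul] give the
    products with G. [Paley_PDS_notin1] makes the support of [D] exactly the nonidentity
    elements. *)

Section GroupRingTheory.
Variable gT : finGroupType.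
Implicit Types (A B : zgroup_ring gT) (S : {set gT}) (g h : gT).

(** The arguments are swapped so that reading off a coefficient becomes an additive morphism, from
    which the linearity lemmas follow. *)
Definition zg_coef_at g A : int := zg_coef A g.

Fact zg_coef_at_is_zmod_morphism g : zmod_morphism (zg_coef_at g).
Proof. by move=> A B; rewrite /zg_coef_at /zg_coef !ffunE. Qed.

HB.instance Definition _ g := GRing.isZmodMorphism.Build (zgroup_ring gT) int
  (zg_coef_at g) (zg_coef_at_is_zmod_morphism g).

Lemma zg_coefN A g : zg_coef (- A) g = - zg_coef A g.
Proof. exact: (raddfN (zg_coef_at g)). Qed.

Lemma zg_coefMn A n g : zg_coef (A *+ n) g = zg_coef A g *+ n.
Proof. exact: (raddfMn (zg_coef_at g)). Qed.

Lemma zg_coefMz A (n : int) g : zg_coef (A *~ n) g = zg_coef A g * n.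
Proof. by rewrite -mulrzz; exact: (raddfMz (zg_coef_at g)). Qed.

Lemma zg_coef_sum I (r : seq I) (P : pred I) (F : I -> zgroup_ring gT) g :
  zg_coef (\sum_(i <- r | P i) F i) g = \sum_(i <- r | P i) zg_coef (F i) g.
Proof. exact: (raddf_sum (zg_coef_at g)). Qed.

Lemma zg_coef1 g : zg_coef 1 g = (g == 1%g)%:R.
Proof. exact: zg_coef_elt. Qed.

Lemma zg_coefM A B g :
  zg_coef (A * B) g = \sum_h zg_coef A h * zg_coef B (h^-1 * g)%g.
Proof. exact: zg_coef_mul. Qed.

Lemma zg_coef_set S g : zg_coef (zg_set S) g = (g \in S)%:R.
Proof.
rewrite zg_coef_sum; under eq_bigr do rewrite zg_coef_elt.
case: (boolP (g \in S)) => gS.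
  rewrite (bigD1 g) //= eqxx big1 ?addr0 // => h /andP[_ /negPf].
  by rewrite eq_sym => ->.
by rewrite big1 // => h hS; case: eqP gS => // ->; rewrite hS.
Qed.

Lemma zg_coef_inv A g : zg_coef (zg_inv A) g = zg_coef A g^-1%g.
Proof.
rewrite zg_coef_sum (bigD1 g^-1%g) //= big1 => [|h hg].
  by rewrite zg_coefMz zg_coef_elt invgK eqxx mul1r addr0.
by rewrite zg_coefMz zg_coef_elt -eq_invg_sym eq_sym (negPf hg) mul0r.
Qed.

Lemma zg_invK A : zg_inv (zg_inv A) = A.
Proof. by apply: zg_coefP => g; rewrite !zg_coef_inv invgK. Qed.

Lemma zg_invM A B : zg_inv (A * B) = zg_inv B * zg_inv A.
Proof.
apply: zg_coefP => g; rewrite zg_coef_inv !zg_coefM.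
rewrite (reindex_inj (mulgI g^-1%g)) /=; apply: eq_bigr => h _.
by rewrite !zg_coef_inv mulrC !invMg !invgK mulgK.
Qed.

Lemma zg_mul_setT A :
  A * zg_set [set: gT] = zg_set [set: gT] *~ \sum_h zg_coef A h.
Proof.
apply: zg_coefP => g; rewrite zg_coefM zg_coefMz zg_coef_set inE mul1r.
by apply: eq_bigr => h _; rewrite zg_coef_set inE mulr1.
Qed.

(** The group may be nonabelian, so the left-hand version is transported from [zg_mul_setT] by
    inversion, an anti-automorphism that fixes G. *)
Lemma zg_setT_mul A :
  zg_set [set: gT] * A = zg_set [set: gT] *~ \sum_h zg_coef A h.
Proof.
have invT : zg_inv (zg_set [set: gT]) = zg_set [set: gT].
  by apply: zg_coefP => g; rewrite zg_coef_inv !zg_coef_set !inE.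
rewrite -[LHS]zg_invK zg_invM invT zg_mul_setT.
apply: zg_coefP => g; rewrite zg_coef_inv !zg_coefMz !zg_coef_set !inE.
congr (_ * _); rewrite (reindex_inj invg_inj) /=.
by apply: eq_bigr => h _; rewrite zg_coef_inv invgK.
Qed.

Lemma zg_sum_coef_set S : \sum_h zg_coef (zg_set S) h = #|S|%:Z.
Proof.
under eq_bigr do rewrite zg_coef_set.
by rewrite -natr_sum -big_mkcond /= sum1_card natz.
Qed.

Lemma zg_coef_mul_inv_set S :
  zg_coef (zg_set S * zg_inv (zg_set S)) 1%g = #|S|%:Z.
Proof.
rewrite -zg_sum_coef_set zg_coefM; apply: eq_bigr => h _.
rewrite zg_coef_inv mulg1 invgK zg_coef_set.
by case: (h \in S).
Qed.

End GroupRingTheory.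

Lemma Paley_PDS_eq {gT : finGroupType} {v : nat} {D' : {set gT}} :
  is_Paley_PDS D' v -> exists m : nat,
  [/\ #|gT| = (4 * m + 1)%N, #|D'| = (2 * m)%N
    & zg_set D' * zg_inv (zg_set D')
      = zg_set [set: gT] *~ m%:Z - zg_set D' + 1 *~ m%:Z].
Proof.
move=> [k [lambda [mu [[gTv D'k eqS] kE lambdaE muE]]]].
have {}muE : v%:Z = 4 * mu + 1.
  by apply: (@intr_inj rat); rewrite rmorphD rmorphM /=; lra.
have muQ : v%:Q = 4 * mu%:~R + 1 by rewrite muE rmorphD rmorphM.
have {}kE : k%:Z = 2 * mu by apply: (@intr_inj rat); rewrite rmorphM /=; lra.
have {}lambdaE : lambda = mu - 1.
  by apply: (@intr_inj rat); rewrite rmorphB /=; lra.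
(* [mu] is nonnegative because 2 [mu] is the natural number [k]. *)
have muE' : mu = `|mu|%N%:Z by lia.
exists `|mu|%N; split; [lia | lia |].
rewrite eqS -muE' lambdaE; apply: zg_coefP => g.
rewrite !(zg_coefD, zg_coefN, zg_coefMz, zg_coefMn) -mulr_natr natz kE.
by ring.
Qed.

(** G and 1 are fixed by inversion, as is S S^-1, so the one remaining term -S of the equation must
    be fixed too. *)
Lemma Paley_PDS_sym {gT : finGroupType} {v : nat} {D' : {set gT}} :
  is_Paley_PDS D' v -> zg_inv (zg_set D') = zg_set D'.
Proof.
move=> /Paley_PDS_eq[m [_ _ eqS]].
have := congr1 (@zg_inv gT) eqS; rewrite zg_invM zg_invK eqS => symE.
apply: zg_coefP => g; move/(congr1 (@zg_coef gT ^~ g)): symE.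
rewrite !(zg_coef_inv, zg_coefD, zg_coefN, zg_coefMz, zg_coef1).
rewrite !(zg_coef_set _ [set: gT]) !inE eq_invg1.
by lra.
Qed.

(** At the identity, S S^-1 has coefficient |D'| = 2m, while the right-hand side has 2m minus the
    indicator of 1 in D'. *)
Lemma Paley_PDS_notin1 {gT : finGroupType} {v : nat} {D' : {set gT}} :
  is_Paley_PDS D' v -> 1%g \notin D'.
Proof.
move=> /Paley_PDS_eq[m [_ D'm eqS]].
have := zg_coef_mul_inv_set _ D'; rewrite eqS D'm.
rewrite !(zg_coefD, zg_coefN, zg_coefMz, zg_coef1, zg_coef_set) inE eqxx.
by case: (1%g \in D') => //; lia.
Qed.

Theorem theorem3p7 (gT : finGroupType) (v : nat) (D' : {set gT})
    (hv : #|gT| = v) (hD' : is_Paley_PDS D' v) :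
  exists D : zgroup_ring gT, is_SDS D v (v - 1)%N (-1).
Proof.
have [m [gTm D'm eqS]] := Paley_PDS_eq hD'.
have symS := Paley_PDS_sym hD'.
have D'1 := Paley_PDS_notin1 hD'.
set S := zg_set D' in eqS symS *; set G := zg_set [set: gT] in eqS *.
pose D : zgroup_ring gT := S *+ 2 - G + 1.
have coefD g : zg_coef D g = (g \in D')%:R *+ 2 - 1 + (g == 1%g)%:R.
  by rewrite 2!zg_coefD zg_coefN zg_coefMn zg_coef1 !zg_coef_set inE.
have invD : zg_inv D = D.
  apply: zg_coefP => g; rewrite zg_coef_inv !coefD eq_invg1.
  by rewrite -!zg_coef_set -zg_coef_inv symS.
exists D; split=> //.
  (* The required list of distinct elements is the enumeration of the nonidentity elements. *)
  have cardC1 : (v - 1)%N = #|[set~ 1%g : gT]| by rewrite cardsC1 hv subn1.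
  rewrite cardC1; exists (@enum_val gT (mem [set~ 1%g])).
  exists (fun i => if enum_val i \in D' then 1 else -1).
  split; [exact: enum_val_inj | by move=> i; case: ifP; [right | left] |].
  rewrite -(big_enum_val (fun g => zg_elt g *~ (if g \in D' then 1 else -1))).
  apply: zg_coefP => g; rewrite coefD zg_coef_sum.
  under eq_bigr do rewrite zg_coefMz zg_coef_elt.
  (* At the identity the coefficient of [D] is 0 - 1 + 1 = 0, as 1 is not in [D']. *)
  have [->|g1] := eqVneq g 1%g.
    rewrite (negPf D'1) big1 // => h; rewrite !inE eq_sym => /negPf ->.
    by rewrite mul0r.
  rewrite (bigD1 g) ?inE //= eqxx big1 => [|h /andP[_ /negPf]].
    by case: ifP.
  by rewrite eq_sym => ->; rewrite mul0r.
rewrite invD.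
have SS : S * S = G *~ m%:Z - S + 1 *~ m%:Z by rewrite -eqS symS.
have SG : S * G = G *~ (2 * m)%N%:Z by rewrite zg_mul_setT zg_sum_coef_set D'm.
have GS : G * S = G *~ (2 * m)%N%:Z by rewrite zg_setT_mul zg_sum_coef_set D'm.
have GG : G * G = G *~ (4 * m + 1)%N%:Z.
  by rewrite zg_mul_setT zg_sum_coef_set cardsT gTm.
rewrite /D !(mulrDl, mulrDr, mulr1, mul1r, mulNr, mulrN, mulrnAl, mulrnAr).
rewrite SS SG GS GG; apply: zg_coefP => g.
(* The S terms cancel, G gets 4m - 8m + (4m + 1) - 2 = -1, and the identity gets 4m + 1 = v. *)
rewrite -hv gTm addnK -/G !(zg_coefD, zg_coefN, zg_coefMz, zg_coefMn).
by ring.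
Qed.
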